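(* Let $X$ be an infinite set. If $S$ is a monoid such that $\mathrm{Sym}_X\cup \mathrm{DBL}_X\leq S\leq \mathrm{Surj}_X$ (i.e. $S$ is a submonoid of $\mathrm{Surj}_X$ containing $\mathrm{Sym}_X\cup \mathrm{DBL}_X$), then $D_l(S)=4$. In particular, the monoids $\mathrm{Sym}_X\cup \mathrm{DBL}_X$ and $\mathrm{Surj}_X$ have left diameter $4$.
   Context: Maps are written on the right and composed from left to right. $\mathrm{Sym}_X$ is the symmetric group on $X$ (all bijections $X\to X$); $\mathrm{Surj}_X$ is the monoid of all surjective maps $X\to X$; $\mathrm{DBL}_X=\{\alpha\in\mathrm{Surj}_X : |x\alpha^{-1}|=|X|\text{ for all }x\in X\}$ is the dual Baer-Levi semigroup. Left diameter. For a semigroup $S$, $S^1$ is $S$ with an identity adjoined if $S$ has none ($S^1=S$ if $S$ is a monoid). A left congruence on $S$ is an equivalence relation $\rho$ such that $(a,b)\in\rho$ implies $(sa,sb)\in\rho$ for all $s\in S$; $\langle U\rangle$ denotes the smallest left congruence containing $U\subseteq S\times S$. The universal relation $S\times S$ viewed as a left congruence is denoted $\omega_S^l$; it is finitely generated if $\omega_S^l=\langle U\rangle$ for some finite $U\subseteq S\times S$. A $U$-sequence of length $n\geq 1$ from $a$ to $b$ is a sequence $a=s_1u_1,\ s_1v_1=s_2u_2,\ \dots,\ s_nv_n=b$ where, for each $i$, $(u_i,v_i)\in U$ or $(v_i,u_i)\in U$, and $s_i\in S^1$; if $a=b$ then $a,b$ are related by a $U$-sequence of length $0$. If $\omega_S^l=\langle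 U\rangle$, let $d_U^l(a,b)$ be the least length of a $U$-sequence from $a$ to $b$ and $D_l(U,S)=\sup\{d_U^l(a,b):a,b\in S\}$. If $\omega_S^l$ is finitely generated, the left diameter of $S$ is $D_l(S)=\min\{D_l(U,S): \omega_S^l=\langle U\rangle,\ U\text{ finite}\}$. Saying $D_l(S)=n$ (or ''$S$ has left diameter $n$'') includes the assertion that $\omega_S^l$ is finitely generated. *)

(* Defs.v *)
From HB Require Import structures.
From mathcomp Require Import all_boot all_order.
From mathcomp Require Import boolp classical_sets functions cardinality.

Set Implicit Arguments.
Unset Strict Implicit.
Unset Printing Implicit Defensive.

Local Open Scope group_scope.
Local Open Scope classical_set_scope.
Local Open Scope card_scope.

Section LeftDiameter.
Variable T : semigroupType.
Implicit Types (a b : T) (U rho : set (T * T)) (n : nat).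

Definition left_congruence rho : Prop :=
  [/\ forall a, rho (a, a),
      forall a b, rho (a, b) -> rho (b, a),
      forall a b c, rho (a, b) -> rho (b, c) -> rho (a, c)
    & forall s a b, rho (a, b) -> rho (s * a, s * b)].

Definition left_congruence_gen U : set (T * T) := smallest left_congruence U.

Definition generates_univ U : Prop := left_congruence_gen U = [set: T * T].

Definition has_identity : Prop := exists e : T, forall a, e * a = a /\ a * e = a.

(* The elements of T^1 are encoded in option T, where None is the adjoined
   identity; it is present only when T has no identity of its own. *)
Definition adjoin1 : set (option T) := [set s | s = None -> ~ has_identity].

Definition adjoin1_mul (s : option T) a : T := if s is Some t then t * a else a.

Fixpoint Useq U n a b : Prop :=
  if n is m.+1 then
    exists s u v, [/\ adjoin1 s, U (u, v) \/ U (v, u),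
                      a = adjoin1_mul s u & Useq U m (adjoin1_mul s v) b]
  else a = b.

(* d_U^l(a, b) = n *)
Definition Udist U a b n : Prop :=
  Useq U n a b /\ forall m, Useq U m a b -> (n <= m)%N.

(* D_l(U, T) = n. The supremum is taken in nat, so no n satisfies this when
   the distances are unbounded, i.e. when D_l(U, T) is infinite. *)
Definition Udiameter U n : Prop :=
  supremums [set m | exists a b, Udist U a b m] n.

(* D_l(T) = n. In particular the universal left congruence is then finitely
   generated. *)
Definition left_diameter n : Prop :=
  let D := [set m | exists U, [/\ finite_set U, generates_univ U
                                & Udiameter U m]] in
  D n /\ lbound D n.

End LeftDiameter.

Section SubmonoidType.
Variables (M : monoidType) (S : umagmaClosed M).

Definition submonoid : Type := {x : M | x \in S}.

Lemma submonoid_closed : monoid_closed S.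
Proof. by split; [exact: gpred1 | exact: gpredM]. Qed.

HB.instance Definition _ := SubChoice.copy submonoid {x : M | x \in S}.
HB.instance Definition _ :=
  SubChoice_isSubMonoid.Build M _ submonoid submonoid_closed.

End SubmonoidType.

Definition transf (X : Type) : Type := X -> X.

Section Transformations.
Variable X : Type.

HB.instance Definition _ := gen_eqMixin (transf X).
HB.instance Definition _ := gen_choiceMixin (transf X).

(* Maps act on the right: f * g is f followed by g. *)
Definition transf_mul (f g : transf X) : transf X := g \o f.
Definition transf_one : transf X := id.

Lemma transf_mulA : associative transf_mul. Proof. by []. Qed.
Lemma transf_mul1x : left_id transf_one transf_mul. Proof. by []. Qed.
Lemma transf_mulx1 : right_id transf_one transf_mul. Proof. by []. Qed.

HB.instance Definition _ :=
  isMonoid.Build (transf X) transf_mulA transf_mul1x transf_mulx1.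

Definition Sym : {pred transf X} := [pred f | `[< bijective f >]].

Definition Surj : {pred transf X} :=
  [pred f | `[< set_surj [set: X] [set: X] f >]].

Definition DBL : {pred transf X} :=
  [pred f in Surj | `[< forall x, f @^-1` [set x] #= [set: X] >]].

Definition SymDBL : {pred transf X} := [predU Sym & DBL].

Lemma SymP (f : transf X) : reflect (bijective f) (f \in Sym).
Proof. by rewrite inE; apply: asboolP. Qed.

Lemma SurjP (f : transf X) :
  reflect (forall y, exists x, f x = y) (f \in Surj).
Proof.
rewrite inE; apply: (iffP (asboolP _)) => [fS y | fS y _].
  by have [x _ <-] := fS y I; exists x.
by have [x <-] := fS y; exists x.
Qed.

Lemma DBLP (f : transf X) :
  reflect (f \in Surj /\ forall x, f @^-1` [set x] #= [set: X]) (f \in DBL).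
Proof.
by rewrite inE /=; apply: (iffP andP) => -[fS fD]; split=> //; apply/asboolP.
Qed.

Lemma Surj1 : 1 \in Surj.
Proof. by apply/SurjP => y; exists y. Qed.

Lemma SurjM : mulg_closed Surj.
Proof.
move=> f g /SurjP fS /SurjP gS; apply/SurjP => z.
by have [y <-] := gS z; have [x <-] := fS y; exists x.
Qed.

HB.instance Definition _ := isMulClosed.Build (transf X) Surj SurjM.
HB.instance Definition _ := isMul1Closed.Build (transf X) Surj Surj1.

Lemma Sym_Surj : {subset Sym <= Surj}.
Proof. by move=> f /SymP[g _ fK]; apply/SurjP => y; exists (g y). Qed.

Lemma DBL_Surj : {subset DBL <= Surj}.
Proof. by move=> f /DBLP[]. Qed.

Lemma SymDBL_Surj : {subset SymDBL <= Surj}.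
Proof. by move=> f /orP[/Sym_Surj|/DBL_Surj]. Qed.

Lemma DBL_mulr (f g : transf X) : f \in DBL -> g \in Surj -> f * g \in DBL.
Proof.
move=> /DBLP[fS fD] gS; apply/DBLP; split=> [|z]; first exact: SurjM.
have [y gyz] := SurjP _ gS z.
rewrite card_eq_le card_leT /=.
rewrite -(card_le_eql (fD y)); apply: subset_card_le => x /= fxy.
by rewrite -gyz -fxy.
Qed.

Lemma DBL_mull (f g : transf X) : f \in Surj -> g \in DBL -> f * g \in DBL.
Proof.
move=> fS /DBLP[gS gD]; apply/DBLP; split=> [|z]; first exact: SurjM.
rewrite card_eq_le card_leT /=.
rewrite -(card_le_eql (gD z)).
have sub : g @^-1` [set z] `<=` f @` ((f * g) @^-1` [set z]).
  by move=> y /= gyz; have [x fxy] := SurjP _ fS y; exists x; rewrite //= -gyz -fxy.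
exact: card_le_trans (subset_card_le sub) (card_image_le _ _).
Qed.

Lemma SymDBL1 : 1 \in SymDBL.
Proof. by apply/orP; left; apply/SymP; exists id. Qed.

Lemma SymDBLM : mulg_closed SymDBL.
Proof.
move=> f g fSD gSD; apply/orP.
have [fS gS] := (SymDBL_Surj fSD, SymDBL_Surj gSD).
case/orP: fSD => [/SymP fB | fD]; last by right; apply: DBL_mulr.
case/orP: gSD => [/SymP gB | gD]; last by right; apply: DBL_mull.
by left; apply/SymP; apply: bij_comp.
Qed.

HB.instance Definition _ := isMulClosed.Build (transf X) SymDBL SymDBLM.
HB.instance Definition _ := isMul1Closed.Build (transf X) SymDBL SymDBL1.

End Transformations.

Arguments Sym : clear implicits.
Arguments Surj : clear implicits.
Arguments DBL : clear implicits.
Arguments SymDBL : clear implicits.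

(* Main.v *)
Require Import Defs.
From HB Require Import structures.
From mathcomp Require Import all_boot all_order.
From mathcomp Require Import boolp classical_sets functions cardinality.
From mathcomp Require wochoice.

(** Upper bound. Call a family of maps on [X] full if all joint fibres have
    the cardinality of [X]. Two full maps from [X] to the same set differ by a
    permutation of [X] on the left ([full_fibres_conj]). Fix [u] and [v] in DBL
    such that [(u, v) : X -> X * X] is full, and take the two generating pairs
    [(1, u)] and [(u, v)]. For any [a] and [b] the maps [a u] and [b u] are in
    DBL, and there is a [d] such that both [(a u, d)] and [(b u, d)] are full
    ([transverse_map]): every value of [d] is taken often on each fibre of
    [a u] and on each fibre of [b u]. So there are permutations [s] and [t]
    with [(a u, d) = s (u, v)] and [(b u, d) = t (u, v)], and the path
    [a, a u = s u, s v = d = t v, t u = b u, b] has length 4. Fibres of [a u]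
    and of [b u] may meet in an arbitrary way, so [d] comes from a system of
    distinct representatives for a family of [|X|] sets of size [|X|], chosen
    along a well-order of [X] whose initial segments are smaller than [X]. That
    full pairs exist at all rests on [|X * X| = |X|] ([card_square_le]).

    Lower bound. Suppose that [1 = s1 u1], [s1 v1 = s2 u2], [s2 v2 = s3 u3] and
    [s3 v3 = b] for a permutation [b]. Surjectivity forces [s1], [u1], [s3]
    and [v3] to be permutations. With [p = u1^-1 v1] and [q = v3^-1 u3] the two
    middle equations read [p = s2 u2] and [b q = s2 v2], so that [(p, b q)] and
    [(u2, v2)] have the same image in [X * X], as [s2] is onto. For a finite
    generating set there are finitely many [p], [q] and images [R] of
    [(u2, v2)], and [avoid_joint_images] produces a permutation [b] for which
    the image of [(p, b q)] is never [R]. Finitely many values of [b] are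
    prescribed first, each putting a pair outside [R] into the image for some
    triple [(p, q, R)], as long as unused points allow it ([defeat_or_full]).
    For each remaining triple [R] contains all pairs [(p x, q w)] with [x] and
    [w] unused, and it is enough to keep one such pair out of the image. This
    asks [b] to carry a finite union of fibres of the [p]'s off a finite union
    of fibres of the [q]'s, which is possible when together these fibres miss
    [|X|] points ([sparse_fibres]). *)

Set Implicit Arguments.
Unset Strict Implicit.
Unset Printing Implicit Defensive.

Local Open Scope group_scope.
Local Open Scope classical_set_scope.
Local Open Scope card_scope.

(** * Comparison of cardinals *)

Lemma card_le_funP (T U : Type) (u0 : U) (A : set T) (B : set U) :
  A #<= B <->
  exists f : T -> U, (forall x, A x -> B (f x)) /\
    (forall x y, A x -> A y -> f x = f y -> x = y).
Proof.
pose pU : pointedType := HB.pack U (gen_eqMixin U) (gen_choiceMixin U)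
  (isPointed.Build U u0).
split=> [/(@pcard_leP T pU)/injfunPex[f fAB f_inj] | [f [fAB f_inj]]].
  by exists f; split=> // x y Ax Ay; apply: f_inj; rewrite inE.
apply/(@pcard_leP T pU)/injfunPex; exists f => // x y.
by rewrite !inE; apply: f_inj.
Qed.

Lemma card_le_fun (T U : Type) (u0 : U) (A : set T) (B : set U) :
  A #<= B ->
  exists f : T -> U, (forall x, A x -> B (f x)) /\
    (forall x y, A x -> A y -> f x = f y -> x = y).
Proof. by move/(card_le_funP u0). Qed.

Lemma fun_card_le (T U : Type) (f : T -> U) (A : set T) (B : set U) :
  (forall x, A x -> B (f x)) ->
  (forall x y, A x -> A y -> f x = f y -> x = y) -> A #<= B.
Proof.
move=> fAB f_inj; have [->|/set0P[x _]] := eqVneq A set0; first exact: card_ge0.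
by apply/(card_le_funP (f x)); exists f.
Qed.

Lemma card_eq_bij (T U : Type) (u0 : U) (A : set T) (B : set U) :
  A #= B -> exists f : T -> U, [/\ forall x, A x -> B (f x),
    forall x y, A x -> A y -> f x = f y -> x = y &
    forall y, B y -> exists2 x, A x & f x = y].
Proof.
pose pU : pointedType := HB.pack U (gen_eqMixin U) (gen_choiceMixin U)
  (isPointed.Build U u0).
case/(@card_set_bijP T pU) => f [fAB f_inj f_surj]; exists f; split=> //.
by move=> x y Ax Ay; apply: f_inj; rewrite inE.
Qed.

(** Partial injections are kept as graphs, because for graphs the union of a
    chain, which Zorn's lemma asks for, is a plain union of sets. *)
Definition matching (T U : Type) (G : set (T * U)) : Prop :=
  forall p q, G p -> G q -> p.1 = q.1 <-> p.2 = q.2.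

Lemma matching_bigcup (T U : Type) (F : set (set (T * U))) :
  (forall G, F G -> matching G) -> total_on F subset ->
  matching (\bigcup_(G in F) G).
Proof.
move=> Fm Ftot p q [G FG Gp] [H FH Hq].
by have [sub|sub] := Ftot _ _ FG FH;
  [apply: (Fm H) => //; apply: sub | apply: (Fm G) => //; apply: sub].
Qed.

Lemma matching_card_le (T U : Type) (u0 : U) (G : set (T * U))
    (A : set T) (B : set U) :
  matching G -> (forall x, A x -> exists2 y, B y & G (x, y)) -> A #<= B.
Proof.
move=> Gm AG.
have : forall x, exists y, A x -> B y /\ G (x, y).
  move=> x; have [/AG[y By Gxy]|nAx] := pselect (A x); last by exists u0.
  by exists y.
case/choice => f fP; apply: (fun_card_le (f := f)) => [x /fP[]|] //.
by move=> x y /fP[_ Gx] /fP[_ Gy] e; apply/(Gm _ _ Gx Gy).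
Qed.

(** Zorn's lemma gives a maximal partial injection from [A] to [B]; if it
    missed a point on each side, that pair could be added to it. *)
Lemma card_le_total (T U : Type) (A : set T) (B : set U) :
  A #<= B \/ B #<= A.
Proof.
have [->|/set0P[a0 Aa0]] := eqVneq A set0; first by left; exact: card_ge0.
have [->|/set0P[b0 Bb0]] := eqVneq B set0; first by right; exact: card_ge0.
pose P (G : set (T * U)) :=
  matching G /\ forall p, G p -> A p.1 /\ B p.2.
have [|G [[Gm GAB] Gmax]] := @Zorn_bigcup _ P.
  move=> F FP Ftot; split; first by apply: matching_bigcup => // H /FP[].
  by move=> p [H /FP[_ HAB] /HAB].
have [domG|] := pselect (forall x, A x -> exists y, G (x, y)).
  left; apply: (matching_card_le b0 Gm) => x Ax.
  by have [y Gxy] := domG x Ax; exists y => //; have [] := GAB _ Gxy.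
move=> /existsNP[x /not_implyP[Ax nGx]].
have [ranG|] := pselect (forall y, B y -> exists x, G (x, y)).
  right; apply: (@matching_card_le _ _ a0 [set p | G (p.2, p.1)]) => [p q Gp Gq|y By].
    by have := Gm _ _ Gp Gq => /=; tauto.
  by have [z Gzy] := ranG y By; exists z => //; have [] := GAB _ Gzy.
move=> /existsNP[y /not_implyP[By nGy]].
exfalso; apply: (Gmax (G `|` [set (x, y)])).
  split; first by move=> p; left.
  by move=> /(_ (x, y) (or_intror erefl)) Gxy; apply: nGx; exists y.
split=> [p q [Gp|->] [Gq|->]|p [/GAB//|->//]] //=; first exact: Gm.
- case: p Gp => a b Gab /=; split=> e; exfalso.
    by apply: nGx; exists b; rewrite -e.
  by apply: nGy; exists a; rewrite -e.
- case: q Gq => a b Gab /=; split=> e; exfalso.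
    by apply: nGx; exists b; rewrite e.
  by apply: nGy; exists a; rewrite e.
Qed.

Lemma card_leX (T T' U U' : Type) (A : set T) (B : set T') (C : set U)
    (D : set U') :
  A #<= C -> B #<= D -> A `*` B #<= C `*` D.
Proof.
move=> AC BD.
have [->|/set0P[[a b] [/= Aa Bb]]] := eqVneq (A `*` B) set0; first exact: card_ge0.
have [c _] : C !=set0.
  by apply/set0P; apply: contraTneq AC => ->; rewrite card_le0; apply/set0P; exists a.
have [d _] : D !=set0.
  by apply/set0P; apply: contraTneq BD => ->; rewrite card_le0; apply/set0P; exists b.
have [f [fAC f_inj]] := card_le_fun c AC.
have [g [gBD g_inj]] := card_le_fun d BD.
apply: (fun_card_le (f := fun p => (f p.1, g p.2))) => [p []|].
  by split; [apply: fAC|apply: gBD].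
by move=> [x y] [x' y'] [/= Ax By] [/= Ax' By'] [/f_inj-> // /g_inj->].
Qed.

(** [A] and [B] go to two disjoint columns of [C `*` C]. *)
Lemma card_leU (T U : Type) (A B : set T) (C : set U) :
  infinite_set C -> C `*` C #<= C -> A #<= C -> B #<= C -> A `|` B #<= C.
Proof.
move=> Cinf CC AC BC; apply: card_le_trans CC.
have [c Cc] := infinite_setN0 Cinf.
have [c' [Cc' ne]] : C `\ c !=set0.
  apply: infinite_setN0; apply: infinite_setD => //; exact: finite_set1.
have [f [fAC f_inj]] := card_le_fun c AC.
have [g [gBC g_inj]] := card_le_fun c BC.
pose h x := if `[<A x>] then (c, f x) else (c', g x).
apply: (fun_card_le (f := h)) => [x | x y]; rewrite /h.
  case: asboolP => [Ax _|nAx [//|Bx]]; split => //=; [exact: fAC|exact: gBC].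
case: asboolP => Ax; case: asboolP => Ay ABx ABy [].
- exact: f_inj.
- by move=> e; case: ne.
- by move=> e; case: ne.
- by case: ABx => // Bx; case: ABy => // By; apply: g_inj.
Qed.

(** * The square of an infinite cardinal *)

Section Square.
Variable X : Type.
Implicit Types (G : set ((X * X) * X)) (x y z : X).

Definition diag_dom G : set X := [set x | exists z, G ((x, x), z)].

(** The graph of an injection from [Y `*` Y] to [Y], where [Y] is read off the
    graph as [diag_dom G]. *)
Definition square_matching G : Prop :=
  [/\ matching G,
      forall x y z, G ((x, y), z) -> [/\ diag_dom G x, diag_dom G y & diag_dom G z]
    & forall x y, diag_dom G x -> diag_dom G y -> exists z, G ((x, y), z)].

Lemma square_matching_card G :
  square_matching G -> diag_dom G `*` diag_dom G #<= diag_dom G.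
Proof.
move=> [Gm Gsub Gtot].
have [->|/set0P[x0 _]] := eqVneq (diag_dom G `*` diag_dom G) set0.
  exact: card_ge0.
apply: (matching_card_le x0.1 Gm) => -[x y] [/= Dx Dy].
by have [z Gz] := Gtot _ _ Dx Dy; exists z => //; have [] := Gsub _ _ _ Gz.
Qed.

Lemma square_matching_bigcup (F : set (set ((X * X) * X))) :
  F `<=` square_matching -> total_on F subset ->
  square_matching (\bigcup_(G in F) G).
Proof.
move=> FP Ftot; split.
- by apply: matching_bigcup => // G /FP[].
- move=> x y z [G FG /(let: And3 _ s _ := FP _ FG in s)[Dx Dy Dz]].
  by split; [case: Dx|case: Dy|case: Dz] => t Gt; exists t, G.
- move=> x y [a [G FG Ga]] [b [H FH Hb]].
  have [sub|sub] := Ftot _ _ FG FH.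
    have [_ _ /(_ x y)[||z Hz]] := FP _ FH; [|by exists b|by exists z, H].
    by exists a; apply: sub.
  have [_ _ /(_ x y)[||z Hz]] := FP _ FG; [by exists a| |by exists z, G].
  by exists b; apply: sub.
Qed.

(** The new pairs, those of [(Y `|` Z) `*` (Y `|` Z)] outside [Y `*` Y], can be
    sent into [Z], whose square is no larger than [Z]; this cannot collide with
    the old values, which lie in [Y]. *)
Lemma square_matching_extend G (Z : set X) :
  square_matching G -> infinite_set Z -> Z `*` Z #<= Z ->
  diag_dom G #<= Z -> (forall x, Z x -> ~ diag_dom G x) ->
  exists2 H, square_matching H & G `<` H.
Proof.
move=> [Gm Gsub Gtot] Zinf ZZ YZ Zdis; set Y := diag_dom G in YZ Zdis.
have [z0 Zz0] := infinite_setN0 Zinf.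
pose W := Y `|` Z.
have WZ : W #<= Z by apply: card_leU => //; exact: card_lexx.
have WWZ : W `*` W #<= Z by apply: card_le_trans ZZ; apply: card_leX.
have [k [kZ k_inj]] := card_le_fun z0 WWZ.
pose N : set ((X * X) * X) :=
  [set p | [/\ W p.1.1, W p.1.2, ~ (Y p.1.1 /\ Y p.1.2) & p.2 = k p.1]].
have GY p : G p -> Y p.1.1 /\ Y p.1.2 /\ Y p.2.
  by case: p => -[x y] z /Gsub[].
have NZ p : N p -> Z p.2 by case: p => -[x y] z [/= Wx Wy _ ->]; apply: kZ.
have domW : diag_dom (G `|` N) = W.
  apply/seteqP; split=> x; first by move=> [z [/GY[/= Yx _]|[//]]]; left.
  move=> Wx.
  have [[z Gz]|nYx] := pselect (Y x); first by exists z; left.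
  by exists (k (x, x)); right; split=> // -[].
exists (G `|` N); last first.
  split; first by move=> p; left.
  have Nz0 : N ((z0, z0), k (z0, z0)).
    by split=> //=; [right|right|move=> [/(Zdis _ Zz0)]].
  by move=> /(_ _ (or_intror Nz0))/GY[/= /(Zdis _ Zz0)].
split.
- move=> p q [Gp|Np] [Gq|Nq].
  + exact: Gm.
  + have [Y1 [Y2 Y3]] := GY _ Gp; have [_ _ nY _] := Nq; split=> e.
      by case: nY; rewrite -e.
    by case: (Zdis q.2); [exact: NZ | rewrite -e].
  + have [Y1 [Y2 Y3]] := GY _ Gq; have [_ _ nY _] := Np; split=> e.
      by case: nY; rewrite e.
    by case: (Zdis p.2); [exact: NZ | rewrite e].
  + case: p q Np Nq => [p z] [q t] [/= W1 W2 _ ->] [/= W3 W4 _ ->].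
    by split=> [->|/k_inj->].
- move=> x y z GNp; rewrite domW.
  case: GNp => [/GY[/= Yx [Yy Yz]]|]; first by split; left.
  by move=> Np; case: (Np) => /= Wx Wy _ _; split=> //; right; exact: NZ Np.
- rewrite domW => x y Wx Wy.
  have [[Yx Yy]|nY] := pselect (Y x /\ Y y).
    by have [z Gz] := Gtot _ _ Yx Yy; exists z; left.
  by exists (k (x, y)); right.
Qed.

Lemma countable_infinite_sub (A : set X) :
  infinite_set A -> exists Z, [/\ Z `<=` A, infinite_set Z & countable Z].
Proof.
move=> Ainf; have [x0 _] := infinite_setN0 Ainf.
have /infiniteP/(card_le_fun x0)[f [fA f_inj]] := Ainf.
exists (range f); split.
- by move=> _ [n _ <-]; apply: fA.
- by apply/infiniteP/(fun_card_le (f := f)) => // n _; exists n.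
- exact: card_image_le.
Qed.

Lemma countable_infinite_square (Z : set X) :
  infinite_set Z -> countable Z -> Z `*` Z #<= Z.
Proof.
move=> /infiniteP Zinf Zc; apply: card_le_trans Zinf.
exact: countableX.
Qed.

(** Take a maximal injection from [Y `*` Y] to [Y]. The set [Y] is infinite,
    since otherwise a countable set outside [Y] would allow an extension, and
    the complement of [Y] contains no copy of [Y] for the same reason. Hence the
    complement is no larger than [Y], and neither is [X]. *)
Theorem card_square_le : infinite_set [set: X] -> [set: X * X] #<= [set: X].
Proof.
move=> Xinf.
have [//|G [GP Gmax]] := Zorn_bigcup (P := square_matching).
  by move=> F FP Ftot; apply: square_matching_bigcup.
have noext Z : infinite_set Z -> Z `*` Z #<= Z ->
    diag_dom G #<= Z -> ~ (forall x, Z x -> ~ diag_dom G x).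
  move=> Zi ZZ YZ dis.
  by have [H HP /Gmax] := square_matching_extend GP Zi ZZ YZ dis.
set Y := diag_dom G in noext.
have YY : Y `*` Y #<= Y by exact: square_matching_card.
have [Yfin|Yinf] := pselect (finite_set Y).
  have [|Z [ZY Zinf Zc]] := @countable_infinite_sub ([set: X] `\` Y).
    exact: infinite_setD.
  exfalso; apply: (noext Z) => //; last by move=> x /ZY[].
    exact: countable_infinite_square.
  by move/infiniteP: Zinf; apply: card_le_trans; apply: finite_set_countable.
have [le|le] := card_le_total (~` Y) Y.
  have XY : [set: X] #<= Y.
    by rewrite -(setUv Y); apply: card_leU => //; exact: card_lexx.
  have XXYY : [set: X * X] #<= Y `*` Y.
    by rewrite -setXTT; apply: card_leX.
  exact: card_le_trans (card_le_trans XXYY YY) (card_leT Y).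
have [y0 _] := infinite_setN0 Yinf.
have [f [fY f_inj]] := card_le_fun y0 le.
have ZY : f @` Y #= Y.
  by apply: inj_card_eq => x y; rewrite !inE; apply: f_inj.
exfalso; apply: (noext (f @` Y)).
- by rewrite (eq_finite_set ZY).
- have [ZY1 ZY2] : f @` Y #<= Y /\ Y #<= f @` Y by apply/andP; rewrite -card_eq_le.
  exact: card_le_trans (card_leX ZY1 ZY1) (card_le_trans YY ZY2).
- by move: ZY; rewrite card_eq_le => /andP[].
- by move=> _ [x Yx <-]; apply: fY.
Qed.
End Square.

(** * Sets as large as an infinite type *)

Lemma inj_surj_bij (T U : Type) (f : T -> U) :
  injective f -> (forall y, exists x, f x = y) -> bijective f.
Proof.
move=> f_inj /choice[g fg]; exists g => // x.
by apply: f_inj; rewrite fg.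
Qed.

Section FullSets.
Variable X : Type.
Hypothesis X_infinite : infinite_set [set: X].
Implicit Types A B C D : set X.

Lemma full_card A : [set: X] #<= A -> A #= [set: X].
Proof. by move=> XA; rewrite card_eq_le card_leT. Qed.

Lemma square_bij : exists f : X * X -> X, bijective f.
Proof.
have [x0 _] := infinite_setN0 X_infinite.
have : [set: X * X] #= [set: X].
  rewrite card_eq_le card_square_le //=.
  by apply: (fun_card_le (f := fun x => (x, x))) => // x y _ _ [].
case/(card_eq_bij x0) => f [_ f_inj f_surj]; exists f.
apply: inj_surj_bij => [x y|y]; first exact: f_inj.
by have [x _ <-] := f_surj y I; exists x.
Qed.

(** Split a copy of [X * X]. Either some row lies in [A], or every row meets [B]
    and one point of [B] per row gives a copy of [X]. *)
Lemma full_setU A B :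
  [set: X] #<= A `|` B -> [set: X] #<= A \/ [set: X] #<= B.
Proof.
have [x0 _] := infinite_setN0 X_infinite.
case/(card_le_fun x0) => f [fAB f_inj].
have [e e_bij] := square_bij; have e_inj := bij_inj e_bij.
have [[x xA]|] := pselect (exists x, forall y, A (f (e (x, y)))).
  left; apply: (fun_card_le (f := fun y => f (e (x, y)))) => // y z _ _.
  by move/(f_inj _ _ I I)/e_inj => [].
move/forallNP => nA; right.
have /choice[g gB] : forall x, exists y, B (f (e (x, y))).
  by move=> x; have /existsNP[y] := nA x; exists y; case: (fAB (e (x, y)) I).
apply: (fun_card_le (f := fun x => f (e (x, g x)))) => // y z _ _.
by move/(f_inj _ _ I I)/e_inj => [].
Qed.

Lemma full_setD_finite A F :
  [set: X] #<= A -> finite_set F -> [set: X] #<= A `\` F.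
Proof.
move=> XA Ffin.
have [|//|XF] := @full_setU (A `\` F) F.
  apply: card_le_trans XA _; apply: subset_card_le => x Ax.
  by have [|] := pselect (F x); [right|left].
by case: X_infinite; apply: card_le_finite XF Ffin.
Qed.

(** If some initial segment of a well-order is as large as [X], take the
    shortest such segment and pull its order back to [X]. *)
Lemma initial_well_order : exists lt : X -> X -> Prop,
  [/\ well_founded lt, forall x y, x <> y -> lt x y \/ lt y x
    & forall y, ~ ([set: X] #<= [set x | lt x y])].
Proof.
have [x0 _] := infinite_setN0 X_infinite.
pose T : eqType := HB.pack X (gen_eqMixin X).
have [R Rwo] := wochoice.well_ordering_principle T.
have min (P : X -> Prop) : (exists x, P x) ->
    exists2 m, P m & forall x, P x -> R m x.
  case=> x Px; have [|m [[mP mmin] _]] := Rwo [pred x : T | `[<P x>]].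
    by exists x; apply/asboolP.
  exists m; first exact/asboolP.
  by move=> y Py; apply: mmin; apply/asboolP.
have Rtot x y : R x y \/ R y x.
  have [|m] := min (fun z => z = x \/ z = y); first by exists x; left.
  by case=> -> mmin; [left; apply: mmin; right|right; apply: mmin; left].
have Ranti x y : R x y -> R y x -> x = y.
  move=> Rxy Ryx.
  have [|m [_ muniq]] := Rwo [pred z : T | `[<z = x \/ z = y>]].
    by exists x; apply/asboolP; left.
  have Rxx : R x x by have [] := Rtot x x.
  have Ryy : R y y by have [] := Rtot y y.
  rewrite -(muniq x) ?(muniq y) //; split; try (by apply/asboolP; auto);
    by move=> z /asboolP[->|->].
pose lt0 x y := R x y /\ x <> y.
have lt0_wf : well_founded lt0.
  move=> x; apply: contrapT => nx.
  have [|m nm mmin] := min (fun x => ~ Acc lt0 x); first by exists x.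
  apply: nm; constructor => y [Rym ney]; apply: contrapT => /mmin Rmy.
  by apply: ney; apply: Ranti.
have lt0_tot x y : x <> y -> lt0 x y \/ lt0 y x.
  by move=> ne; have [] := Rtot x y; [left|right; split=> // e; apply: ne].
have [small|] := pselect (forall y, ~ ([set: X] #<= [set x | lt0 x y])).
  by exists lt0.
move=> /existsNP[y /contrapT big].
have [|m mbig mmin] := min (fun y => [set: X] #<= [set x | lt0 x y]).
  by exists y.
have [f [fm f_inj]] := card_le_fun x0 mbig.
exists (fun x y => lt0 (f x) (f y)); split.
- suff acc z : Acc lt0 z -> forall x, f x = z -> Acc (fun x y => lt0 (f x) (f y)) x.
    by move=> x; apply: acc (lt0_wf (f x)) _ _.
  elim=> {}z _ IH x fx; constructor=> u ltu.
  by apply: (IH (f u)); rewrite -?fx.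
- by move=> x z ne; apply: lt0_tot => /(f_inj _ _ I I).
- move=> z le.
  have /mmin Rm : [set: X] #<= [set x | lt0 x (f z)].
    apply: card_le_trans le _; apply: (fun_card_le (f := f)) => // u v _ _.
    exact: f_inj.
  by have [Rf ne] := fm z I; apply: ne; apply: Ranti.
Qed.

(** Well-founded recursion along [initial_well_order]: at stage [i] fewer than
    [|X|] points have been used, and they do not exhaust [A i]. *)
Lemma distinct_representatives (A : X -> set X) :
  (forall i, [set: X] #<= A i) ->
  exists2 g : X -> X, injective g & forall i, A i (g i).
Proof.
move=> Abig; have [lt [lt_wf lt_tot lt_small]] := initial_well_order.
have [x0 _] := infinite_setN0 X_infinite.
pose used i (rec : forall j, lt j i -> X) : set X :=
  [set y | exists j (h : lt j i), rec j h = y].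
have pick_ex i rec : exists y, A i y /\ ~ @used i rec y.
  apply: contrapT => /forallNP nex; apply: (lt_small i).
  have {nex} sub : A i `<=` used i rec.
    by move=> y Ay; apply: contrapT => nu; apply: (nex y).
  apply: card_le_trans (Abig i) _; apply: card_le_trans (subset_card_le sub) _.
  pose rec' j := if pselect (lt j i) is left h then rec j h else x0.
  apply: card_le_trans (card_image_le rec' _); apply: subset_card_le.
  move=> _ [j [h <-]]; exists j => //; rewrite /rec'.
  by case: pselect => // h'; congr (rec j _); apply: Prop_irrelevance.
pose step i rec := projT1 (cid (@pick_ex i rec)).
pose g := Fix lt_wf (fun=> X) step.
have gE i : g i = step i (fun j _ => g j).
  apply: Fix_eq => x r r' rr'; congr step.
  by apply: functional_extensionality_dep => y; apply: functional_extensionality_dep => h.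
have gP i : A i (g i) /\ forall j, lt j i -> g j <> g i.
  rewrite (gE i) /step; case: cid => y /= [Ay nu]; split=> // j h e.
  by apply: nu; exists j, h.
exists g => [i j e|i]; last by have [] := gP i.
have [//|/lt_tot[h|h]] := pselect (i = j).
  by have [_ /(_ _ h e)] := gP j.
by have [_ /(_ _ h (esym e))] := gP i.
Qed.

Lemma conj_of_fibres (Y : Type) (phi psi : X -> Y) :
  (forall y, phi @^-1` [set y] #= psi @^-1` [set y]) ->
  exists2 s : X -> X, bijective s & forall x, psi (s x) = phi x.
Proof.
move=> eq_fib; have [x0 _] := infinite_setN0 X_infinite.
have /choice[f fP] := fun y => card_eq_bij x0 (eq_fib y).
exists (fun x => f (phi x) x) => [|x]; last by case: (fP (phi x)) => h _ _; apply: h.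
have fK x : psi (f (phi x) x) = phi x by case: (fP (phi x)) => h _ _; apply: h.
apply: inj_surj_bij => [x y e|z].
  have ep : phi x = phi y by rewrite -fK e fK.
  by case: (fP (phi x)) => _ inj _; apply: inj => //; rewrite e ep.
have [_ _ /(_ z erefl)[x /= <- fx]] := fP (psi z).
by exists x.
Qed.

Lemma full_fibres_conj (Y : Type) (phi psi : X -> Y) :
  (forall y, [set: X] #<= phi @^-1` [set y]) ->
  (forall y, [set: X] #<= psi @^-1` [set y]) ->
  exists2 s : X -> X, bijective s & forall x, psi (s x) = phi x.
Proof.
move=> phiX psiX; apply: conj_of_fibres => y.
by rewrite (card_eql (full_card (phiX y))) card_eq_sym full_card.
Qed.

(** For every [z], reserve [|X|] points in each fibre of [b] and of [c], and let
    [d] be [z] on them. Points reserved for different [z] have to be different,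
    hence the distinct representatives. *)
Lemma transverse_map (b c : X -> X) :
  (forall y, [set: X] #<= b @^-1` [set y]) ->
  (forall y, [set: X] #<= c @^-1` [set y]) ->
  exists d : X -> X,
    (forall y z, [set: X] #<= [set x | b x = y /\ d x = z]) /\
    (forall y z, [set: X] #<= [set x | c x = y /\ d x = z]).
Proof.
move=> bX cX.
have [x0 _] := infinite_setN0 X_infinite.
have [x1 [_ ne]] : [set: X] `\ x0 !=set0.
  by apply: infinite_setN0; apply: infinite_setD => //; exact: finite_set1.
have [e [e' eK e'K]] := square_bij.
(* The representative indexed by the code of (s, y, z, k) is the k-th point for
   the value z, in the fibre at y of b if s = x0 and of c otherwise. *)
pose code s y z k := e (e (s, y), e (z, k)).
pose A i : set X :=
  let y := (e' (e' i).1).2 in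
  if `[<(e' (e' i).1).1 = x0>] then b @^-1` [set y] else c @^-1` [set y].
have [|g g_inj gA] := @distinct_representatives A.
  by move=> i; rewrite /A; case: asboolP.
have code_inj s y z k k' : code s y z k = code s y z k' -> k = k'.
  by move=> /(can_inj eK)[/(can_inj eK)[]].
pose d x := if pselect (exists i, g i = x) is left h
  then (e' (e' (projT1 (cid h))).2).1 else x0.
have dg s y z k : d (g (code s y z k)) = z.
  rewrite /d; case: pselect => [h|[]]; last by exists (code s y z k).
  by case: cid => j /= /g_inj->; rewrite /code !eK.
exists d; split=> y z.
  apply: (fun_card_le (f := fun k => g (code x0 y z k))) => [k _|k k' _ _].
    split; last exact: dg.
    by have := gA (code x0 y z k); rewrite /A /code !eK /= asboolT.
  by move=> /g_inj/code_inj.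
apply: (fun_card_le (f := fun k => g (code x1 y z k))) => [k _|k k' _ _].
  split; last exact: dg.
  by have := gA (code x1 y z k); rewrite /A /code !eK /= asboolF.
by move=> /g_inj/code_inj.
Qed.

End FullSets.

(** * Avoiding finitely many joint images *)

Lemma exchange_bij (X : Type) (A : set X) (h : X -> X) :
  (forall x y, A x -> A y -> h x = h y -> x = y) -> (forall x, A x -> ~ A (h x)) ->
  exists t : X -> X, [/\ bijective t, forall x, A x -> t x = h x
    & forall x, ~ A x -> (forall y, A y -> h y <> x) -> t x = x].
Proof.
move=> h_inj hA.
pose t x := if pselect (A x) is left _ then h x else
  if pselect (exists2 y, A y & h y = x) is left e then s2val (cid2 e) else x.
have tA x : A x -> t x = h x by rewrite /t; case: pselect.
have th x : A x -> t (h x) = x.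
  move=> Ax; rewrite /t; case: pselect => [/(hA _ Ax)//|nA].
  case: pselect => [e|[]]; last by exists x.
  by case: cid2 => y /= Ay /h_inj->.
have tN x : ~ A x -> (forall y, A y -> h y <> x) -> t x = x.
  move=> nA nh; rewrite /t; case: pselect => // _.
  by case: pselect => // -[y Ay yx]; case: (nh y).
exists t; split=> //; suff tt x : t (t x) = x by exists t.
have [Ax|nA] := pselect (A x); first by rewrite (tA _ Ax) th.
have [[y Ay <-]|nh] := pselect (exists2 y, A y & h y = x).
  by rewrite th // tA.
by rewrite !tN // => y Ay e; apply: nh; exists y.
Qed.

Lemma transposition_bij (X : Type) (a b : X) :
  exists t : X -> X, [/\ bijective t, t a = b
    & forall x, x <> a -> x <> b -> t x = x].
Proof.
have [<-|ne] := pselect (a = b); first by exists id; split=> //; exists id.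
have [x y -> ->|_ _ /esym//|t [tb ta tN]] := @exchange_bij X [set a] (fun=> b).
  by [].
exists t; split=> // [|x xa xb]; first by rewrite ta.
by apply: tN => // y _ e; apply: xb.
Qed.

Section Avoidance.
Variables (X : Type) (I : eqType) (p q : I -> X -> X) (R : I -> set (X * X)).

(** In both alternatives the bijection matters only through its restriction to
    [F]. A triple for which the second one fails supplies an unused pair
    [(x, w)] with [(p x, q w)] outside [R], and composing [g] with a
    transposition makes [x] go to [w] without changing [g] on [F]. *)
Lemma defeat_or_full (s : seq I) : exists (g : X -> X) (F : set X),
  [/\ bijective g, finite_set F & forall i, i \in s ->
      (exists2 x, F x & ~ R i (p i x, q i (g x)))
      \/ (forall x w, ~ F x -> ~ (g @` F) w -> R i (p i x, q i w))].
Proof.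
elim: s => [|i s [g [F [g_bij Ffin gF]]]].
  by exists id, set0; split=> //; exists id.
have [full|] := pselect (forall x w, ~ F x -> ~ (g @` F) w -> R i (p i x, q i w)).
  exists g, F; split=> // j; rewrite inE => /predU1P[->|/gF//]; by right.
move=> /existsNP[x /existsNP[w /not_implyP[nFx /not_implyP[nFw nR]]]].
have [t [t_bij tx tN]] := transposition_bij (g x) w.
have tgF y : F y -> t (g y) = g y.
  move=> Fy; apply: tN => [/(bij_inj g_bij) e|e]; first by apply: nFx; rewrite -e.
  by apply: nFw; exists y.
exists (t \o g), (F `|` [set x]); split.
- exact: bij_comp.
- by rewrite finite_setU; split=> //; exact: finite_set1.
- move=> j; rewrite inE => /predU1P[->|/gF[[y Fy nRj]|full]].
  + by left; exists x; [right | rewrite /= tx].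
  + by left; exists y; [left | rewrite /= tgF].
  + right=> y v nFy nv; apply: full => [Fy|[z Fz zv]]; first by apply: nFy; left.
    by apply: nv; exists z; [left | rewrite /= tgF].
Qed.
End Avoidance.

Section FiniteAvoidance.
Variable X : Type.
Hypothesis X_infinite : infinite_set [set: X].

Lemma two_outside_finite (F : set X) : finite_set F ->
  exists y z, [/\ ~ F y, ~ F z & y <> z].
Proof.
move=> Ffin; have Finf := infinite_setD X_infinite Ffin.
have [y [_ nFy]] := infinite_setN0 Finf.
have [z [[_ nFz] ne]] := infinite_setN0 (infinite_setD Finf (finite_set1 y)).
by exists y, z; split=> // /esym.
Qed.

(** The fibres are removed one at a time. Of two disjoint fibres of the next map
    at least one can be removed from [C] leaving [|X|] points, because the two
    remainders cover [C]. *)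
Lemma sparse_fibres (G : set X) (s : seq (transf X)) : finite_set G ->
  exists C : set X, [/\ [set: X] #<= C, forall x, C x -> ~ G x
    & forall r, r \in s ->
      exists y, (forall x, G x -> r x <> y) /\ (forall x, C x -> r x <> y)].
Proof.
move=> Gfin; elim: s => [|r s [C [XC CG Cs]]].
  exists (~` G); split=> //; rewrite -setTD.
  by apply: full_setD_finite => //; exact: card_lexx.
have [y [z [ny nz yz]]] := two_outside_finite (finite_image r Gfin).
have Gav t : ~ (r @` G) t -> forall x, G x -> r x <> t.
  by move=> nt x Gx e; apply: nt; exists x.
have [|XD|XD] := @full_setU _ X_infinite (C `&` [set x | r x <> y])
    (C `&` [set x | r x <> z]).
- apply: card_le_trans XC _; apply: subset_card_le => x Cx.
  have [e|] := pselect (r x = y); last by left.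
  by right; split=> //= ez; apply: yz; rewrite -e -ez.
- exists (C `&` [set x | r x <> y]); split=> // [x [/CG]//|r'].
  rewrite inE => /predU1P[->|/Cs[t [Gt Ct]]]; last by exists t; split=> // x [/Ct].
  by exists y; split; [exact: Gav | move=> x []].
- exists (C `&` [set x | r x <> z]); split=> // [x [/CG]//|r'].
  rewrite inE => /predU1P[->|/Cs[t [Gt Ct]]]; last by exists t; split=> // x [/Ct].
  by exists z; split; [exact: Gav | move=> x []].
Qed.

(** The permutation is [g] of [defeat_or_full] followed by an involution [t]
    that exchanges the chosen fibres of the [p i], transported by [g], with part
    of the set [C] of [sparse_fibres]. As [C] misses the chosen fibres of the
    [q i], the pair [(y i, z i)] of chosen values leaves the image; the
    involution fixes [g @` F], so the triples settled by [g] stay settled. *)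
Lemma avoid_joint_images (I : eqType) (p q : I -> transf X)
    (R : I -> set (X * X)) (s : seq I) :
  (forall i, i \in s -> p i \in Surj X) -> (forall i, i \in s -> q i \in Surj X) ->
  exists2 b : X -> X, bijective b
    & forall i, i \in s -> range (fun x => (p i x, q i (b x))) <> R i.
Proof.
move=> pS qS; have [x0 _] := infinite_setN0 X_infinite.
have [g [F [g_bij Ffin gF]]] := @defeat_or_full _ _ p q R s.
have [g' gK g'K] := g_bij.
have [C [XC CG Cs]] := @sparse_fibres (g @` F)
  ([seq (p i \o g' : transf X) | i <- s] ++ [seq q i | i <- s])
  (finite_image g Ffin).
have /choice[y yP] : forall i, exists y, i \in s ->
    (forall x, F x -> p i x <> y) /\ (forall x, C x -> p i (g' x) <> y).
  move=> i; case: (boolP (i \in s)) => [si|_]; last by exists x0.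
  have [|y [Gy Cy]] := Cs (p i \o g').
    by rewrite mem_cat (map_f (fun i => p i \o g' : transf X)).
  exists y => _; split=> // x Fx e; apply: (Gy (g x)); first by exists x.
  by rewrite /= gK.
have /choice[z zP] : forall i, exists z, i \in s ->
    (forall x, F x -> q i (g x) <> z) /\ (forall x, C x -> q i x <> z).
  move=> i; case: (boolP (i \in s)) => [si|_]; last by exists x0.
  have [|z [Gz Cz]] := Cs (q i); first by rewrite mem_cat map_f ?orbT.
  by exists z => _; split=> // x Fx; apply: Gz; exists x.
pose A : set X := [set x | exists2 i, i \in s & p i (g' x) = y i].
have [h [hC h_inj]] := card_le_fun x0 (card_le_trans (card_leT A) XC).
have CA x : C x -> ~ A x by move=> Cx [i /yP[_ /(_ x Cx)]].
have [x z' /= |x Ax|t [t_bij tA tN]] := @exchange_bij X A h; [exact: h_inj| |].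
  by apply: CA; exact: hC.
have tF x : F x -> t (g x) = g x.
  move=> Fx; apply: tN => [[i /yP[+ _] ]|w Aw e].
    by rewrite gK; apply.
  by apply: (CG (g x)); [rewrite -e; exact: hC | exists x].
exists (t \o g) => [|i si e]; first exact: bij_comp.
have [yF yC] := yP _ si; have [zF zC] := zP _ si.
have [[x Fx]|full] := gF _ si.
  by rewrite -e; apply; exists x; rewrite //= tF.
have [x px] := SurjP _ (pS _ si) (y i); have [w qw] := SurjP _ (qS _ si) (z i).
have : R i (y i, z i).
  rewrite -px -qw; apply: full => [/yF//|[v Fv vw]].
  by apply: (zF v); rewrite // vw.
rewrite -e => -[v _ [pv]].
have Av : A (g v) by exists i; rewrite ?gK.
by rewrite /= tA //; apply: zC; exact: hC.
Qed.
End FiniteAvoidance.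

(** * The left diameter of a monoid *)

Section MonoidDiameter.
Variable M : monoidType.
Implicit Types (a b : M) (U : set (M * M)) (n : nat).

Lemma UseqS U n a b : Useq U n.+1 a b <->
  exists s u v, [/\ U (u, v) \/ U (v, u), a = s * u & Useq U n (s * v) b].
Proof.
have id1 : has_identity M by exists 1 => c; rewrite mul1g mulg1.
split=> [[[s|] [u [v [s1 Uuv ea st]]]]|[s [u [v [Uuv ea st]]]]].
- by exists s, u, v.
- by case: (s1 erefl id1).
- by exists (Some s), u, v.
Qed.

Lemma Useq_cons U n s u v b :
  U (u, v) \/ U (v, u) -> Useq U n (s * v) b -> Useq U n.+1 (s * u) b.
Proof. by move=> Uuv st; apply/UseqS; exists s, u, v. Qed.

Lemma Useq_cat U m n a b c : Useq U m a b -> Useq U n b c -> Useq U (m + n) a c.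
Proof.
elim: m a => [a -> //|m IH a] /UseqS[s [u [v [Uuv -> st]]]] bc.
by rewrite addSn; apply: Useq_cons Uuv _; apply: IH.
Qed.

Lemma Useq_sym U n a b : Useq U n a b -> Useq U n b a.
Proof.
elim: n a => [//|n IH a] /UseqS[s [u [v [Uuv -> /IH st]]]].
rewrite -addn1; apply: Useq_cat st _; apply: Useq_cons => //; tauto.
Qed.

Lemma Useq_mull U n c a b : Useq U n a b -> Useq U n (c * a) (c * b).
Proof.
elim: n a => [a -> //|n IH a] /UseqS[s [u [v [Uuv -> /IH st]]]].
by rewrite mulgA; apply: Useq_cons Uuv _; rewrite -mulgA.
Qed.

Lemma Useq_sub U V n a b : U `<=` V -> Useq U n a b -> Useq V n a b.
Proof.
move=> UV; elim: n a => [//|n IH a] /UseqS[s [u [v [Uuv -> /IH st]]]].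
by apply: Useq_cons st; case: Uuv => /UV; auto.
Qed.

(** The pair [(1, 1)] allows idle steps. *)
Lemma Useq_pad U m n a b : U (1, 1) -> (m <= n)%N -> Useq U m a b -> Useq U n a b.
Proof.
move=> U1 /subnK <-; elim: (n - m)%N => // k IH ab.
by rewrite addSn -[a]mulg1; apply: (@Useq_cons _ _ _ 1 1); rewrite ?mulg1; auto.
Qed.

Lemma generates_univP U : generates_univ U <-> forall a b, exists n, Useq U n a b.
Proof.
split=> [genU a b|conn].
  have : left_congruence_gen U (a, b) by rewrite genU.
  move=> /(_ [set p | exists n, Useq U n p.1 p.2]); apply; split.
    split=> /= [c|c d [n cd]|c d e [m cd] [n de]|c d e [n de]].
    - by exists 0%N.
    - by exists n; apply: Useq_sym.
    - by exists (m + n)%N; apply: Useq_cat de.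
    - by exists n; apply: Useq_mull.
  move=> [u v] Uuv; exists 1%N; change (Useq U 1 u v).
  by rewrite -[u]mul1g; apply: (@Useq_cons _ _ _ _ v); [left | rewrite mul1g].
apply/seteqP; split=> // -[a b] _ rho [[rrefl rsym rtrans rmul] Urho].
have [n] := conn a b; elim: n a => [a -> //|n IH a].
move=> /UseqS[s [u [v [Uuv -> /IH]]]]; apply: rtrans; apply: rmul.
by case: Uuv => /Urho //; apply: rsym.
Qed.

Lemma left_diameterP n :
  (exists2 U : set (M * M), finite_set U & forall a b, Useq U n a b) ->
  (forall U : set (M * M), finite_set U ->
     exists a b, forall m, (m < n)%N -> ~ Useq U m a b) ->
  left_diameter M n.
Proof.
move=> [U Ufin Un] far; split=> [|m [V [Vfin Vgen [Vub _]]]].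
  exists U; split=> //; first by apply/generates_univP => a b; exists n.
  split=> [m [a [b [_ mmin]]]|m ub]; first by rewrite leEnat; apply: mmin.
  have [a [b ab]] := far U Ufin; apply: ub; exists a, b; split=> // k kab.
  by rewrite leqNgt; apply/negP => /ab.
have [a [b ab]] := far V Vfin.
have /generates_univP/(_ a b) exk := Vgen.
have exk' : exists k, `[<Useq V k a b>] by case: exk => k ?; exists k; apply/asboolP.
have [k /asboolP kab kmin] := ex_minnP exk'.
have nk : (n <= k)%N by rewrite leqNgt; apply/negP => /ab.
rewrite leEnat; apply: leq_trans nk _; rewrite -leEnat; apply: Vub.
by exists a, b; split=> // l lab; apply: kmin; apply/asboolP.
Qed.
End MonoidDiameter.

(** * Monoids between Sym and DBL together and Surj *)

Section BetweenSymDBLAndSurj.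
Variable X : Type.
Hypothesis X_infinite : infinite_set [set: X].

Lemma DBL_full (f : transf X) :
  (forall y, [set: X] #<= f @^-1` [set y]) -> f \in DBL X.
Proof.
have [x0 _] := infinite_setN0 X_infinite.
move=> fX; apply/DBLP; split=> [|y]; last exact: full_card.
apply/SurjP => y; have [g [gf _]] := card_le_fun x0 (fX y).
by exists (g x0); apply: gf.
Qed.

Lemma full_DBL (f : transf X) :
  f \in DBL X -> forall y, [set: X] #<= f @^-1` [set y].
Proof. by move=> /DBLP[_ fX] y; move: (fX y); rewrite card_eq_le => /andP[]. Qed.

Lemma full_joint_map : exists u v : transf X,
  forall y z, [set: X] #<= [set x | u x = y /\ v x = z].
Proof.
have [e [e' eK e'K]] := square_bij X_infinite.
exists (fun x => (e' (e' x).1).1), (fun x => (e' (e' x).1).2) => y z.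
apply: (fun_card_le (f := fun k => e (e (y, z), k))) => [k _|k l _ _].
  by rewrite /= !eK.
by move/(can_inj eK) => [].
Qed.

Lemma full_joint_sub (u v : transf X) :
  (forall y z, [set: X] #<= [set x | u x = y /\ v x = z]) ->
  u \in DBL X /\ v \in DBL X.
Proof.
move=> uv; split; apply: DBL_full => y; apply: card_le_trans (uv y y) _;
  by apply: subset_card_le => x [].
Qed.

Lemma joint_conj (b d u v : transf X) :
  (forall y z, [set: X] #<= [set x | b x = y /\ d x = z]) ->
  (forall y z, [set: X] #<= [set x | u x = y /\ v x = z]) ->
  exists2 s : transf X, s \in Sym X & b = s * u /\ d = s * v.
Proof.
move=> bd uv.
have pairE f g y : (fun x : X => (f x, g x) : X * X) @^-1` [set y] =
    [set x | f x = y.1 /\ g x = y.2].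
  by case: y => y z; apply/seteqP; split=> x /= [-> ->].
have [||s s_bij sP] := @full_fibres_conj X X_infinite _
  (fun x => (b x, d x)) (fun x => (u x, v x)).
- by move=> y; rewrite pairE.
- by move=> y; rewrite pairE.
exists s; first exact/SymP.
by split; apply: functional_extensionality_dep => x; have [] := sP x.
Qed.

Variable S : umagmaClosed (transf X).
Hypotheses (symS : {subset SymDBL X <= S}) (Ssurj : {subset S <= Surj X}).

Lemma SymS f : f \in Sym X -> f \in S.
Proof. by move=> fS; apply: symS; apply/orP; left. Qed.

Lemma DBLS f : f \in DBL X -> f \in S.
Proof. by move=> fS; apply: symS; apply/orP; right. Qed.

(** The path is [a, a u = s u, s v = d = t v, t u = b u, b]. *)
Lemma sub_useq4 : exists2 U : set (submonoid S * submonoid S), finite_set U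
  & forall a b, Useq U 4 a b.
Proof.
have [u [v uv]] := full_joint_map; have [uD vD] := full_joint_sub uv.
have [uS vS] := (DBLS uD, DBLS vD).
pose u' : submonoid S := Sub u uS; pose v' : submonoid S := Sub v vS.
exists [set (1, u'); (u', v')] => [|a b]; first exact: finite_set2.
have auD : \val a * u \in DBL X by apply: DBL_mull => //; apply: Ssurj; exact: valP.
have buD : \val b * u \in DBL X by apply: DBL_mull => //; apply: Ssurj; exact: valP.
have [d [ad bd]] := transverse_map X_infinite (full_DBL auD) (full_DBL buD).
have [s sS [sau sd]] := joint_conj ad uv.
have [t tS [tbu td]] := joint_conj bd uv.
pose s' : submonoid S := Sub s (SymS sS); pose t' : submonoid S := Sub t (SymS tS).
have e1 : a * u' = s' * u' by apply: val_inj; exact: sau.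
have e2 : b * u' = t' * u' by apply: val_inj; exact: tbu.
have e3 : s' * v' = t' * v' by apply: val_inj; rewrite /= -sd.
rewrite -[a]mulg1; apply: (Useq_cons (v := u')); first by left; left.
rewrite e1; apply: (Useq_cons (v := v')); first by left; right.
rewrite e3; apply: (Useq_cons (v := u')); first by right; right.
rewrite -e2; apply: (Useq_cons (v := 1)); first by right; left.
by rewrite mulg1.
Qed.

(** No sequence of length less than 4 leads from [1] to the permutation given by
    [avoid_joint_images]. Adding [(1, 1)] to [U] reduces to length exactly 3. *)
Lemma sub_no_short_useq (U : set (submonoid S * submonoid S)) : finite_set U ->
  exists a b, forall m, (m < 4)%N -> ~ Useq U m a b.
Proof.
move=> Ufin; pose ev (a : submonoid S) : X -> X := \val a.
pose V := U `|` [set (1, 1)].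
have /finite_seqP[l lV] : finite_set V.
  by rewrite finite_setU; split=> //; exact: finite_set1.
pose E := l ++ [seq (e.2, e.1) | e <- l].
have inE' u v : V (u, v) \/ V (v, u) -> (u, v) \in E.
  rewrite lV mem_cat => -[/= ->//|/= vul]; apply/orP; right.
  by apply/mapP; exists (v, u).
have surj (a : submonoid S) y : exists x, ev a x = y.
  by have /SurjP := Ssurj (valP a); apply.
(* For a permutation this right inverse is the inverse. It is used only for the
   outer maps of the first and last step, which the ends 1 and b of the path
   force to be permutations. *)
have /choice[rinv rinvK] : forall a : submonoid S, exists g : X -> X,
    forall y, ev a (g y) = y.
  by move=> a; have [g] := choice (surj a); exists g.
pose step : Type := (submonoid S * submonoid S)%type.
pose I : eqType := (step * step * step)%type.
pose p (i : I) : transf X := ev i.1.1.2 \o rinv i.1.1.1.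
pose q (i : I) : transf X := ev i.2.1 \o rinv i.2.2.
pose R (i : I) : set (X * X) := range (fun x => (ev i.1.2.1 x, ev i.1.2.2 x)).
pose s : seq I := [seq i <- [seq (d, f) | d <- [seq (e, f) | e <- E, f <- E], f <- E]
  | (p i \in Surj X) && (q i \in Surj X)].
have [i|i|b b_bij bR] := @avoid_joint_images X X_infinite I p q R s.
- by rewrite mem_filter => /andP[/andP[]].
- by rewrite mem_filter => /andP[/andP[]].
have bS : b \in S by apply: SymS; apply/SymP.
exists 1, (Sub b bS) => m m3 Um.
have : Useq V 3 1 (Sub b bS : submonoid S).
  by apply: (@Useq_pad _ _ m) => //; [right | apply: Useq_sub Um; left].
move=> /UseqS[s1 [u1 [v1 [/inE' E1 eq1]]]].
move=> /UseqS[s2 [u2 [v2 [/inE' E2 eq2]]]].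
move=> /UseqS[s3 [u3 [v3 [/inE' E3 eq3 eq4]]]].
(* As s1 and s3 are onto, the first and last equations make u1 and v3 invertible
   with rinv u1 = s1 and b followed by rinv v3 equal to s3. *)
have us1 x : ev u1 (ev s1 x) = x.
  exact: (esym (congr1 (fun a : submonoid S => ev a x) eq1)).
have us2 x : ev u2 (ev s2 x) = ev v1 (ev s1 x).
  exact: (esym (congr1 (fun a : submonoid S => ev a x) eq2)).
have us3 x : ev v2 (ev s2 x) = ev u3 (ev s3 x).
  exact: (congr1 (fun a : submonoid S => ev a x) eq3).
have bE x : ev v3 (ev s3 x) = b x.
  exact: (congr1 (fun a : submonoid S => ev a x) eq4).
pose i : I := ((u1, v1), (u2, v2), (u3, v3)).
have pE x : p i x = ev v1 (ev s1 x).
  rewrite /p /=; congr (ev v1 _); have [y sy] := surj s1 (rinv u1 x).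
  by rewrite -sy; congr (ev s1 _); rewrite -(us1 y) sy rinvK.
have qE x : q i (b x) = ev u3 (ev s3 x).
  rewrite /q /=; congr (ev u3 _); have [y sy] := surj s3 (rinv v3 (b x)).
  by rewrite -sy; congr (ev s3 _); apply: (bij_inj b_bij); rewrite -bE sy rinvK.
apply: (bR i).
  rewrite mem_filter; apply/andP; split.
    apply/andP; split; apply/SurjP => y.
      by have [x] := surj (s1 * v1) y; exists x; rewrite pE.
    by have [x xy] := surj (s3 * u3) y; exists (b x); rewrite qE.
  by apply: allpairs_f => //; apply: allpairs_f.
apply/seteqP; split=> _ [x _ <-].
  by rewrite pE qE -us2 -us3; exists (ev s2 x).
by have [y <-] := surj s2 x; exists y; rewrite // pE qE /= us2 us3.
Qed.

Lemma left_diameter_sub4 : left_diameter (submonoid S) 4.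
Proof. by apply: left_diameterP; [exact: sub_useq4 | exact: sub_no_short_useq]. Qed.

End BetweenSymDBLAndSurj.

Theorem theorem4p17 (X : Type) (X_infinite : infinite_set [set: X]) :
  (forall S : umagmaClosed (transf X),
     {subset SymDBL X <= S} -> {subset S <= Surj X} ->
     left_diameter (submonoid S) 4)
  /\ left_diameter (submonoid (SymDBL X)) 4
  /\ left_diameter (submonoid (Surj X)) 4.
Proof.
have main := @left_diameter_sub4 X X_infinite.
split=> [S symS Ssurj|]; first exact: main.
by split; apply: main => // f; [exact: SymDBL_Surj | exact: SymDBL_Surj].
Qed.
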